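(* Let $(R_\alpha)$ together with a parameter choice rule $\alpha=\alpha(\delta)$ or $\alpha=\alpha(\delta,y^\delta)$ be a (deterministic) regularization method for the equation $F(x)=y$, as defined in the context. For $\eta>0$ let $y^\eta=y+\epsilon(\eta)$, where $\epsilon(\eta)$ is a $\mathcal{Y}$-valued stochastic error such that $\mathbb{E}(d_{\mathcal{Y}}(y,y^\eta))\to 0$ as $\eta\to 0$. Assume that $F(x)=y$ has a unique solution $x^\dagger$, and that all assumptions needed for the deterministic theory, except the bound on the noise, hold with probability one (i.e. $y^\eta\in\mathcal{A}$ almost surely for every $\eta$). Let $\tau(\eta)>0$ satisfy $$\tau(\eta)\to\infty\ \text{ as }\eta\to 0\quad\text{and}\quad\lim_{\eta\to 0}\tau(\eta)\,\mathbb{E}(d_{\mathcal{Y}}(y,y^\eta))=0,$$ and let $R_\alpha(y^\eta)$ be the regularized solution obtained with the same parameter choice rule as in the deterministic setting, with $\delta$ replaced by $\tau(\eta)\,\mathbb{E}(d_{\mathcal{Y}}(y,y^\eta))$. Then $$\lim_{\eta\to 0}\rho_K(x^\dagger,R_\alpha(y^\eta))=0.$$ If, in addition, the regularized solutions $R_\alpha(y^\eta)$ are defined by truncation as described in the context, then $$\lim_{\eta\to 0}\mathbb{E}\bigl(d_{\mathcal{X}}(x^\dagger,R_\alpha(y^\eta))\bigr)=0.$$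
   Context: Setting. $\mathcal{X},\mathcal{Y}$ are Banach (or Hilbert) spaces with metrics $d_{\mathcal{X}},d_{\mathcal{Y}}$ (typically induced by the norms), $F:\mathcal{D}(F)\subset\mathcal{X}\to\mathcal{Y}$ is a (in general nonlinear) operator, and $y\in\mathcal{Y}$ is the exact data. $F$, $y$ and $x^\dagger$ are deterministic. $(\Omega,\mathcal{F},\mathbb{P})$ is a complete probability space; all random quantities are defined on it, and all maps whose probabilities or expectations are taken are assumed measurable. Ky Fan metric. For random variables $X_1,X_2$ with values in a metric space $(\chi,d_\chi)$, $\rho_K(X_1,X_2):=\inf\{\varepsilon>0:\mathbb{P}(d_\chi(X_1,X_2)>\varepsilon)<\varepsilon\}$; deterministic elements are viewed as constant random variables. Deterministic regularization method. This consists of (possibly nonlinear) maps $R_\alpha:\mathcal{D}(R_\alpha)\subset\mathcal{Y}\to\mathcal{X}$, $\alpha>0$, a parameter choice rule assigning to each noise level $\delta>0$ and data $y^\delta$ a value $\alpha=\alpha(\delta)$ (a priori) or $\alpha=\alpha(\delta,y^\delta)$ (a posteriori), and a set $\mathcal{A}\subset\mathcal{Y}$ of data satisfying the assumptions of the deterministic theory other than the noise bound (in particular $R_\alpha(y^\delta)$ is defined for $y^\delta\in\mathcal{A}$ and the chosen $\alpha$), such that $d_{\mathcal{X}}(R_\alpha(y^\delta),x^\dagger)\to 0$ as $\delta\to 0$ for all families of data $y^\delta\in\mathcal{A}$ with $d_{\mathcal{Y}}(y,y^\delta)\le\delta$, where $\alpha$ is given by the rule. The value substituted for $\delta$ in the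 rule is understood to be positive. Truncation. Here $\mathcal{X}$ is a normed space of functions, $d_{\mathcal{X}}$ is induced by its norm, and the true solution satisfies $\|x^\dagger\|\le\varrho$ and $|x^\dagger|\le C$ globally (pointwise) for some fixed $\varrho,C>0$. Let $C_1,C_2>1$. The regularized solutions are defined by truncation if, for underlying regularized solutions $x^\eta$, one sets $$R_\alpha(y^\eta)=\begin{cases}x^\eta,&\|x^\eta\|\le C_1\varrho\ \text{and}\ |x^\eta|\le C_2C,\\ 0,&\text{otherwise.}\end{cases}$$ *)

(* Defs.v *)
From HB Require Import structures.
From mathcomp Require Export all_boot all_order all_algebra.
From mathcomp Require Export all_classical all_reals all_analysis.
Export Order.TTheory GRing.Theory Num.Theory.
Export numFieldNormedType.Exports.

Set Implicit Arguments.
Unset Strict Implicit.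
Unset Printing Implicit Defensive.

Local Open Scope classical_set_scope.
Local Open Scope ring_scope.

(* The metrics are explicit functions because they need not be the ones induced
   by the norms. *)
Record is_metric (R : realType) (T : Type) (dist : T -> T -> R) : Prop := {
  is_metric_ge0 : forall x y, 0 <= dist x y ;
  is_metric_eq0 : forall x y, dist x y = 0 <-> x = y ;
  is_metric_sym : forall x y, dist x y = dist y x ;
  is_metric_triangle : forall x y z, dist x z <= dist x y + dist y z }.

(* The set is never empty, since it contains 2, and it is bounded below by 0, so
   this [inf] is the genuine infimum. *)
Definition ky_fan (d : measure_display) (Omega : measurableType d)
    (R : realType) (P : probability Omega R)
    (T : Type) (dist : T -> T -> R) (X1 X2 : Omega -> T) : R :=
  inf [set e : R | 0 < e /\
         (P [set w | (e < dist (X1 w) (X2 w))%R] < e%:E)%E].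

Inductive choice_rule (R : realType) (Y : Type) : Type :=
  | a_priori of (R -> R)
  | a_posteriori of (R -> Y -> R).

Definition choose_alpha (R : realType) (Y : Type) (rule : choice_rule R Y)
    (delta : R) (yd : Y) : R :=
  match rule with
  | a_priori a => a delta
  | a_posteriori a => a delta yd
  end.

Definition reg_sol (R : realType) (X Y : Type) (Reg : R -> Y -> X)
    (rule : choice_rule R Y) (delta : R) (yd : Y) : X :=
  Reg (choose_alpha rule delta yd) yd.

(* [Reg alpha] stands for a partial map with domain [DReg alpha]; its values
   outside of the domain are irrelevant.  The noise bound is deliberately absent
   from [reg_alpha_gt0] and [reg_defined]. *)
Record regularization_method (R : realType) (X Y : Type)
    (dX : X -> X -> R) (dY : Y -> Y -> R)
    (Reg : R -> Y -> X) (DReg : R -> set Y)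
    (rule : choice_rule R Y) (A : set Y) (y : Y) (xdag : X) : Prop := {
  reg_alpha_gt0 : forall (delta : R) (yd : Y),
    0 < delta -> A yd -> 0 < choose_alpha rule delta yd ;
  reg_defined : forall (delta : R) (yd : Y),
    0 < delta -> A yd -> DReg (choose_alpha rule delta yd) yd ;
  reg_converges : forall yd : R -> Y,
    (forall delta : R, 0 < delta ->
       A (yd delta) /\ dY y (yd delta) <= delta) ->
    dX (reg_sol Reg rule delta (yd delta)) xdag @[delta --> 0^'+] --> 0 }.

(* A space of [V]-valued functions on [S], [ev x s] being the value of x at s.
   Pointwise statements are taken along the filter [N]: [globally [set: S]]
   means "at every point" (functions proper), whereas the filter of conull sets
   of a measure on S gives classes of functions modulo equality almost
   everywhere, such as the elements of L^p. *)
Record function_space (R : realType) (X : normedModType R)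
    (S : Type) (V : normedModType R)
    (N : set_system S) (ev : X -> S -> V) : Prop := {
  fs_filter : Filter N ;
  fs_linear : forall (a : R) (x x' : X),
    \forall s \near N, ev (a *: x + x') s = a *: ev x s + ev x' s ;
  fs_injective : forall x x' : X,
    (\forall s \near N, ev x s = ev x' s) -> x = x' }.

Definition pointwise_bounded (R : realType) (X : Type) (S : Type)
    (V : normedModType R) (N : set_system S) (ev : X -> S -> V)
    (C : R) (x : X) : Prop :=
  \forall s \near N, `|ev x s| <= C.

Definition truncation (R : realType) (X : normedModType R) (S : Type)
    (V : normedModType R) (N : set_system S) (ev : X -> S -> V)
    (B C : R) (x : X) : X :=
  if pselect (`|x| <= B /\ pointwise_bounded N ev C x) then x else 0.

(* Main.v *)
Require Import Defs.
From mathcomp Require Import lra measurable_realfun.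
Set Implicit Arguments.
Unset Strict Implicit.
Unset Printing Implicit Defensive.
Local Open Scope classical_set_scope.
Local Open Scope ring_scope.

(** Write D for the random data error dY y (y_ eta) and delta = tau * E[D] for
    the noise level fed to the parameter choice rule.  The factor tau makes the
    deterministic noise bound D <= delta hold with large probability: by
    Markov's inequality P(D > delta) <= E[D] / delta = 1 / tau, which tends
    to 0.

    On the event D <= delta the deterministic theory applies, but one sample at
    a time, whereas a probability estimate needs one threshold for all samples.
    This uniformity is automatic [regularization_uniform]: convergence holds
    along every admissible family of data, in particular along the family that
    picks the worst admissible data at each noise level.  A family has to be
    admissible at every noise level, so one must know that admissible data
    exist arbitrarily close to y; otherwise deterministic convergence would be
    vacuous.  The random data provide them: P(D > delta) < 1 and y_ eta lies in
    A almost surely, so some sample satisfies both requirements.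

    Hence, for each e > 0 and eta small, P(dX xdag x_ > e) <= 1 / tau, that is,
    x_ converges to xdag in probability.  Convergence in probability is
    convergence in the Ky Fan metric [cvg_in_probability_ky_fan].  Truncation
    bounds dX xdag x_ by rho + C1 * rho almost surely, and convergence in
    probability of a bounded nonnegative family gives convergence of the
    expectations [cvg_in_probability_bounded_expectation]. *)

(** * Extended-real functions tending to zero *)

Lemma nneg_cvge0 (R : realType) (I : Type) (F : set_system I) {FF : Filter F}
    (f : I -> \bar R) :
  (\forall i \near F, (0 <= f i)%E) ->
  (forall r : R, 0 < r -> \forall i \near F, (f i <= r%:E)%E) ->
  f i @[i --> F] --> 0%E.
Proof.
move=> f_ge0 f_le.
have f_fin : \forall i \near F, f i \is a fin_num.
  near=> i; rewrite ge0_fin_numE; last by near: i.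
  by apply: (@le_lt_trans _ _ 1%:E); rewrite ?ltry//; near: i; exact: f_le.
apply/fine_cvgP; split => //; apply/cvgrPdist_le => r r_gt0; near=> i.
have fi : f i \is a fin_num by near: i.
rewrite sub0r normrN /= ger0_norm; last by apply: fine_ge0; near: i.
by rewrite -lee_fin fineK//; near: i; exact: f_le.
Unshelve. all: by end_near. Qed.

Lemma cvge0_lt (R : realType) (I : Type) (F : set_system I) {FF : Filter F}
    (f : I -> \bar R) (r : R) :
  f i @[i --> F] --> 0%E -> 0 < r -> \forall i \near F, (f i < r%:E)%E.
Proof.
move=> /fine_cvgP[f_fin f0] r_gt0; near=> i.
have fi : f i \is a fin_num by near: i.
rewrite -(fineK fi) lte_fin; near: i.
by move/cvgr_lt: f0; apply.
Unshelve. all: by end_near. Qed.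

(** * Tail probabilities and convergence in probability *)

Section probability_tails.
Context d (Omega : measurableType d) (R : realType) (P : probability Omega R).
Implicit Types (Z : Omega -> R) (e M : R).

Lemma measurable_tail Z e : measurable_fun [set: Omega] Z ->
  measurable [set w | e < Z w].
Proof.
move=> mZ; rewrite (_ : [set w | _] = [set: Omega] `&` Z @^-1` `]e, +oo[).
  by apply: mZ => //; exact: measurable_itv.
by rewrite setTI; apply/seteqP; split => w /=; rewrite in_itv /= andbT.
Qed.

Lemma markov_tail Z e : measurable_fun [set: Omega] Z ->
  (forall w, 0 <= Z w) -> 0 < e ->
  (e%:E * P [set w | (e < Z w)%R] <= 'E_P[Z])%E.
Proof.
move=> mZ Z_ge0 e_gt0; have mT := measurable_tail e mZ.
pose X : {RV P >-> R} := mfun_Sub (mem_set mZ).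
have := @markov _ _ _ P X id e e_gt0 (@measurable_id _ _ _) (fun _ => id)
  (fun _ _ _ _ => id).
rewrite (_ : _ \o X = Z); last by apply/funext => w /=; rewrite ger0_norm.
apply: le_trans; apply: lee_wpmul2l; first by rewrite lee_fin ltW.
apply: le_measure; rewrite ?inE //.
  rewrite -[X in measurable X]setTI; apply: emeasurable_fun_c_infty => //.
  by apply/measurable_EFinP; exact: (measurableT_comp (@normr_measurable R setT)).
by move=> w /= eZ; rewrite lee_fin ger0_norm // ltW.
Qed.

(** The counterpart of Markov's inequality for a bounded variable: Z is at most
    e off the tail event and at most M on it. *)
Lemma expectation_le_tail Z e M : measurable_fun [set: Omega] Z ->
  (forall w, 0 <= Z w) -> 0 <= e -> 0 <= M ->
  {ae P, forall w, Z w <= M} ->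
  ('E_P[Z] <= e%:E + M%:E * P [set w | (e < Z w)%R])%E.
Proof.
move=> mZ Z_ge0 e_ge0 M_ge0 Z_le; have mT := measurable_tail e mZ.
rewrite -(expectation_indic P mT) -(expectation_cst P e) unlock.
have mI : measurable_fun [set: Omega]
    (fun w => (\1_[set w | e < Z w] w)%:E : \bar R).
  by apply/measurable_EFinP; exact: measurable_indic.
have mC : measurable_fun [set: Omega] (fun w => (cst e w)%:E : \bar R).
  by apply/measurable_EFinP; exact: measurable_cst.
rewrite -ge0_integralZl // -ge0_integralD //.
- apply: ae_ge0_le_integral => //.
  + by move=> w _; rewrite lee_fin.
  + exact/measurable_EFinP.
  + by move=> w _; rewrite -EFinM -EFinD lee_fin addr_ge0 // mulr_ge0.
  + by apply: emeasurable_funD; [|exact: measurable_funeM].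
  apply: filterS Z_le => w Zw _; rewrite -EFinM -EFinD lee_fin indicE.
  have [_|/negP] := boolP (w \in _); first by rewrite mulr1 -[leLHS]add0r lerD.
  by rewrite in_setE /= => /negP; rewrite -leNgt mulr0 addr0.
- by move=> w _; rewrite -EFinM lee_fin mulr_ge0.
- exact: measurable_funeM.
Qed.

Lemma ae_le_probability (A B : set Omega) : measurable A -> measurable B ->
  {ae P, forall w, A w -> B w} -> (P A <= P B)%E.
Proof.
move=> mA mB [N [mN N0 AB]].
rewrite -(measureU0 mB mN N0); apply: le_measure; rewrite ?inE //.
  exact: measurableU.
move=> w Aw; have [Bw|nBw] := pselect (B w); [by left|right].
by apply: AB => /= /(_ Aw).
Qed.

(** The passage from random to deterministic objects: an almost sure property
    and an event of positive probability share a sample. *)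
Lemma ae_probability_lt1_ex (B : set Omega) (Q : Omega -> Prop) :
  measurable B -> (P B < 1)%E -> {ae P, forall w, Q w} ->
  exists2 w, Q w & ~ B w.
Proof.
move=> mB PB aeQ; apply: contrapT => noQ.
have : (P [set: Omega] <= P B)%E.
  apply: ae_le_probability => //; apply: filterS aeQ => w Qw _.
  by apply: contrapT => nBw; apply: noQ; exists w.
by rewrite probability_setT leNgt PB.
Qed.

Context (I : Type) (F : set_system I) {FF : Filter F}.

(** Once the tail beyond e has probability less than e, the number e belongs to
    the set whose infimum is the Ky Fan distance. *)
Lemma cvg_in_probability_ky_fan (T : Type) (dist : T -> T -> R)
    (X1 : Omega -> T) (X2 : I -> Omega -> T) :
  (forall e : R, 0 < e ->
     P [set w | e < dist (X1 w) (X2 i w)] @[i --> F] --> 0%E) ->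
  ky_fan P dist X1 (X2 i) @[i --> F] --> 0.
Proof.
move=> X2X1; apply/cvgrPdist_le => e e_gt0.
apply: filterS (cvge0_lt (X2X1 _ e_gt0) e_gt0) => i Pe.
rewrite /ky_fan sub0r normrN ger0_norm.
  by apply: ge_inf => //; exists 0 => r [/ltW].
by apply: lb_le_inf; [exists e | move=> r [/ltW]].
Qed.

(** A bounded convergence theorem along an arbitrary filter: the bound
    e + M * P(Z > e) is made smaller than r by taking e = r / 2 and then the
    probability below r / (2 M). *)
Lemma cvg_in_probability_bounded_expectation (Z : I -> Omega -> R) M :
  0 < M ->
  (\forall i \near F, measurable_fun [set: Omega] (Z i)) ->
  (forall i w, 0 <= Z i w) ->
  (\forall i \near F, {ae P, forall w, Z i w <= M}) ->
  (forall e : R, 0 < e -> P [set w | e < Z i w] @[i --> F] --> 0%E) ->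
  ('E_P[Z i])%E @[i --> F] --> 0%E.
Proof.
move=> M_gt0 mZ Z_ge0 Z_le Z0; apply: nneg_cvge0.
  by apply: nearW => i; apply: expectation_ge0.
move=> r r_gt0; have r2_gt0 : 0 < r / 2 by lra.
have rM_gt0 : 0 < r / 2 / M by apply: divr_gt0.
near=> i.
have mZi : measurable_fun [set: Omega] (Z i) by near: i.
apply: (@le_trans _ _ ((r / 2)%:E + M%:E * P [set w | (r / 2 < Z i w)%R])%E).
  by apply: expectation_le_tail => //; rewrite ?ltW //; near: i.
rewrite [in leRHS](splitr r) EFinD leeD2l //.
have rME : M * (r / 2 / M) = r / 2 by rewrite mulrC divfK // gt_eqF.
rewrite -[in leRHS]rME EFinM; apply: lee_wpmul2l; first by rewrite lee_fin ltW.
by apply: ltW; near: i; exact: cvge0_lt (Z0 _ r2_gt0) rM_gt0.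
Unshelve. all: by end_near. Qed.

End probability_tails.

(** * Regularization methods *)

(** Pointwise convergence along all families of data is uniform: at each noise
    level at which some admissible data give an error above e, choose such
    data.  The family so obtained has errors tending to 0, so from some noise
    level on there are no such data.  Admissible data must exist at every
    level, for otherwise there are no families and convergence says nothing. *)
Lemma regularization_uniform (R : realType) (X Y : Type)
    (dX : X -> X -> R) (dY : Y -> Y -> R) (Reg : R -> Y -> X)
    (DReg : R -> set Y) (rule : choice_rule R Y) (A : set Y) (y : Y)
    (xdag : X) :
  regularization_method dX dY Reg DReg rule A y xdag ->
  (forall delta : R, 0 < delta -> exists2 yd, A yd & dY y yd <= delta) ->
  forall e : R, 0 < e -> \forall delta \near 0^'+, forall yd : Y,
    A yd -> dY y yd <= delta -> dX (reg_sol Reg rule delta yd) xdag <= e.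
Proof.
move=> reg A_near e e_gt0.
pose err delta yd := dX (reg_sol Reg rule delta yd) xdag.
(* The witness y at levels delta <= 0 is a mere default. *)
have /choice[worst worstP] (delta : R) : exists yd : Y, 0 < delta ->
    [/\ A yd, dY y yd <= delta & forall z, A z -> dY y z <= delta ->
      e < err delta z -> e < err delta yd].
  have [delta_gt0|] := ltP 0 delta; last by exists y.
  have [[z [Az yz ez]]|no_bad] := pselect (exists z,
    [/\ A z, dY y z <= delta & e < err delta z]).
    by exists z.
  have [yd Ayd yyd] := A_near _ delta_gt0; exists yd => _; split=> // z Az yz ez.
  by exfalso; apply: no_bad; exists z.
have worst0 : err delta (worst delta) @[delta --> 0^'+] --> 0.
  by apply: (reg_converges reg) => delta /worstP[].
near=> delta => yd Ayd yyd; rewrite leNgt; apply/negP.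
have delta_gt0 : 0 < delta by near: delta; exact: nbhs_right_gt.
have [_ _ /(_ _ Ayd yyd) worst_max] := worstP _ delta_gt0.
move/worst_max; apply/negP; rewrite -leNgt.
by near: delta; move/cvgr_le: worst0; apply.
Unshelve. all: by end_near. Qed.

Lemma truncation_norm_le (R : realType) (X : normedModType R) (S : Type)
    (V : normedModType R) (N : set_system S) (ev : X -> S -> V)
    (B C : R) (x : X) : 0 <= B -> `|truncation N ev B C x| <= B.
Proof. by rewrite /truncation; case: pselect => [[? ?]|?] //=; rewrite normr0. Qed.

Theorem theorem3p4
  (R : realType) (X Y : completeNormedModType R)
  (dX : X -> X -> R) (dY : Y -> Y -> R)
  (metric_dX : is_metric dX) (metric_dY : is_metric dY)
  (d : measure_display) (Omega : measurableType d) (P : probability Omega R)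
  (complete_P : measure_is_complete P)
  (DF : set X) (F : X -> Y) (y : Y) (xdag : X)
  (unique_sol : [set x | DF x /\ F x = y] = [set xdag])
  (Reg : R -> Y -> X) (DReg : R -> set Y) (rule : choice_rule R Y) (A : set Y)
  (reg : regularization_method dX dY Reg DReg rule A y xdag)
  (noise : R -> Omega -> Y) (tau : R -> R) :
  let y_ := fun (eta : R) (w : Omega) => y + noise eta w in
  let Enoise := fun eta : R => ('E_P[fun w => dY y (y_ eta w)])%E in
  let delta := fun eta : R => fine ((tau eta)%:E * Enoise eta)%E in
  let x_ := fun (eta : R) (w : Omega) =>
    reg_sol Reg rule (delta eta) (y_ eta w) in
  (forall eta : R, 0 < eta ->
     measurable_fun [set: Omega] (fun w => dY y (y_ eta w))) ->
  (forall eta : R, 0 < eta ->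
     measurable_fun [set: Omega] (fun w => dX xdag (x_ eta w))) ->
  Enoise eta @[eta --> 0^'+] --> 0%E ->
  (forall eta : R, 0 < eta -> {ae P, forall w, A (y_ eta w)}) ->
  (forall eta : R, 0 < eta -> 0 < tau eta) ->
  tau eta @[eta --> 0^'+] --> +oo ->
  ((tau eta)%:E * Enoise eta)%E @[eta --> 0^'+] --> 0%E ->
  (forall eta : R, 0 < eta -> 0 < delta eta) ->
  ky_fan P dX (fun=> xdag) (x_ eta) @[eta --> 0^'+] --> 0
  /\
  (forall (S : Type) (V : normedModType R) (N : set_system S)
     (ev : X -> S -> V) (rho C C1 C2 : R) (xi : R -> Omega -> X),
   function_space N ev ->
   (forall x x' : X, dX x x' = `|x - x'|) ->
   0 < rho -> 0 < C -> 1 < C1 -> 1 < C2 ->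
   `|xdag| <= rho -> pointwise_bounded N ev C xdag ->
   (forall eta : R, 0 < eta -> {ae P, forall w,
      x_ eta w = truncation N ev (C1 * rho) (C2 * C) (xi eta w)}) ->
   ('E_P[fun w => dX xdag (x_ eta w)])%E @[eta --> 0^'+] --> 0%E).
Proof.
move=> y_ Enoise delta x_ mD mE _ y_A tau_gt0 tau_y delta_cvg delta_gt0.
pose D eta w := dY y (y_ eta w).
have D_ge0 eta w : 0 <= D eta w by exact: is_metric_ge0 metric_dY _ _.
have delta0 : delta eta @[eta --> 0^'+] --> 0 by apply: fine_cvg.
have tail_le eta : 0 < eta ->
    (P [set w | (delta eta < D eta w)%R] <= (tau eta)^-1%:E)%E.
  move=> eta_gt0.
  have := markov_tail P (mD _ eta_gt0) (D_ge0 eta) (delta_gt0 _ eta_gt0).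
  have : 0 < delta eta by exact: delta_gt0.
  have t_gt0 := tau_gt0 _ eta_gt0.
  rewrite /delta -/(Enoise eta).
  have : (0 <= Enoise eta)%E by exact: expectation_ge0 (D_ge0 eta).
  (* fine sends +oo to 0, so 0 < delta eta excludes an infinite expectation;
     it also excludes a zero one, which justifies the division by E below. *)
  case: (Enoise eta) => [E||] //= E_ge0; last by rewrite gt0_muley ?ltxx.
  move=> tE; rewrite -lee_pdivlMl // => /le_trans; apply.
  rewrite -EFinM lee_fin invfM -mulrA mulVf ?mulr1 //.
  by move: tE; rewrite pmulr_rgt0 // => /gt_eqF ->.
have tau_inv0 : (tau eta)^-1%:E @[eta --> 0^'+] --> 0%E.
  apply: nneg_cvge0 => [|r r_gt0]; near=> eta.
    by rewrite lee_fin invr_ge0 ltW // tau_gt0 //; near: eta; exact: nbhs_right_gt.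
  have ri : r^-1 < tau eta by near: eta; move/cvgryPgt: tau_y; apply.
  rewrite lee_fin -[leRHS]invrK lef_pV2 ?posrE ?invr_gt0 ?ltW //.
  by rewrite (lt_trans _ ri) // invr_gt0.
(* Admissible data within r of y are found among the samples of y_ eta, for
   eta so small that delta eta <= r and the tail has probability below 1. *)
have A_near (r : R) : 0 < r -> exists2 yd, A yd & dY y yd <= r.
  move=> r_gt0.
  have : \forall eta \near (0 : R)^'+, exists2 yd, A yd & dY y yd <= r.
    near=> eta.
    have eta_gt0 : 0 < eta by near: eta; exact: nbhs_right_gt.
    have dr : delta eta <= r by near: eta; move/cvgr_le: delta0; apply.
    have P1 : (P [set w | (delta eta < D eta w)%R] < 1)%E.
      apply: le_lt_trans (tail_le _ eta_gt0) _.
      by near: eta; exact: (cvge0_lt tau_inv0 ltr01).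
    have [w Aw /negP] := ae_probability_lt1_ex
      (measurable_tail _ (mD _ eta_gt0)) P1 (y_A _ eta_gt0).
    by rewrite -leNgt => Dw; exists (y_ eta w) => //; exact: le_trans Dw dr.
  by move=> /filter_ex[].
have x_cvg (e : R) : 0 < e ->
    P [set w | e < dX xdag (x_ eta w)] @[eta --> 0^'+] --> 0%E.
  move=> e_gt0; apply: (squeeze_cvge _ (cvg_cst 0%E) tau_inv0).
  have [r /= r_gt0 unif] := regularization_uniform reg A_near e_gt0.
  near=> eta; rewrite measure_ge0 /=.
  have eta_gt0 : 0 < eta by near: eta; exact: nbhs_right_gt.
  apply: le_trans (tail_le _ eta_gt0); apply: ae_le_probability.
  - by apply: measurable_tail; exact: mE.
  - by apply: measurable_tail; exact: mD.
  apply: filterS (y_A _ eta_gt0) => w Aw /=; rewrite !ltNge.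
  apply: contra; rewrite (is_metric_sym metric_dX); apply: unif => //.
    rewrite /ball_ /= sub0r normrN ger0_norm ?ltW ?delta_gt0 //.
    by near: eta; move/cvgr_lt: delta0; apply.
  exact: delta_gt0.
split; first exact: cvg_in_probability_ky_fan.
move=> S V N ev rho C C1 C2 xi _ dX_norm rho_gt0 _ C1_gt1 _ xdag_le _ trunc.
have C1_gt0 : 0 < C1 by lra.
apply: (@cvg_in_probability_bounded_expectation _ _ _ P _ _ _ _
  (rho + C1 * rho)) => //.
- by rewrite addr_gt0 // mulr_gt0.
- by near=> eta; apply: mE; near: eta; exact: nbhs_right_gt.
- by move=> eta w; exact: is_metric_ge0 metric_dX _ _.
near=> eta.
have eta_gt0 : 0 < eta by near: eta; exact: nbhs_right_gt.
apply: filterS (trunc _ eta_gt0) => w ->; rewrite dX_norm.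
apply: le_trans (ler_normB _ _) _; apply: lerD => //.
by apply: truncation_norm_le; rewrite ltW // mulr_gt0.
Unshelve. all: by end_near. Qed.
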